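(* Let $(\mathfrak g_\theta,\mu)$ be an averaging Leibniz algebra over a field $\mathbb K$ of characteristic $0$, and let $(\mu_t,\theta_t)$ and $(\mu'_t,\theta'_t)$ be two equivalent formal one-parameter deformations of $(\mathfrak g_\theta,\mu)$. Then their infinitesimals $(\mu_1,\theta_1)$ and $(\mu'_1,\theta'_1)$ are in the same cohomology class, i.e. $(\mu'_1,\theta'_1)-(\mu_1,\theta_1)$ lies in the image of $d^1:C^1_{\mathrm{AL}}(\mathfrak g,\mathfrak g)\to C^2_{\mathrm{AL}}(\mathfrak g,\mathfrak g)$.
   Context: All vector spaces are over a field $\mathbb K$ of characteristic $0$. A (left) Leibniz algebra is a vector space $\mathfrak g$ with a bilinear bracket $\mu(u,v)=[u,v]$ satisfying $[u,[v,w]]=[[u,v],w]+[v,[u,w]]$ for all $u,v,w\in\mathfrak g$. An averaging operator on $\mathfrak g$ is a linear map $\theta:\mathfrak g\to\mathfrak g$ with $[\theta(u),\theta(v)]=\theta([\theta(u),v])=\theta([u,\theta(v)])$ for all $u,v$. A Leibniz algebra with an averaging operator $\theta$ is called an averaging Leibniz algebra, denoted $(\mathfrak g_\theta,\mu)$. Formal deformation. A formal one-parameter deformation of $(\mathfrak g_\theta,\mu)$ is a pair of power series $\mu_t=\sum_{i\ge0}\mu_i t^i$, $\theta_t=\sum_{i\ge0}\theta_i t^i$ with $\mu_i\in\mathrm{Hom}(\mathfrak g^{\otimes 2},\mathfrak g)$, $\theta_i\in\mathrm{Hom}(\mathfrak g,\mathfrak g)$, $(\mu_0,\theta_0)=(\mu,\theta)$,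 such that $\mathfrak g[[t]]$ with the ($\mathbb K[[t]]$-linearly extended) bracket $\mu_t$ and operator $\theta_t$ is an averaging Leibniz algebra. Its infinitesimal is the pair $(\mu_1,\theta_1)$. Equivalence. Two formal one-parameter deformations $(\mu_t,\theta_t)$ and $(\mu'_t,\theta'_t)$ of $(\mathfrak g_\theta,\mu)$ are equivalent if there is a power series $\psi_t=\sum_{i\ge0}\psi_i t^i$ with $\psi_i:\mathfrak g\to\mathfrak g$ linear and $\psi_0=\mathrm{Id}_{\mathfrak g}$ such that $\psi_t\circ\mu'_t=\mu_t\circ(\psi_t\otimes\psi_t)$ and $\psi_t\circ\theta'_t=\theta_t\circ\psi_t$. Cochains (coefficients in $\mathfrak g$ acting on itself by the bracket on both sides). $C^n_{\mathrm{AL}}(\mathfrak g,\mathfrak g)=\mathrm{Hom}(\mathfrak g^{\otimes n},\mathfrak g)\oplus\mathrm{Hom}(\mathfrak g^{\otimes (n-1)},\mathfrak g)$ for $n\ge1$, with $\mathrm{Hom}(\mathfrak g^{\otimes 0},\mathfrak g)=\mathrm{Hom}(\mathbb K,\mathfrak g)\cong\mathfrak g$, and $d^n(f,g)=(\delta^n f,\,-\partial^{n-1}g-\phi^n f)$. In degree $n=1$, for $f\in\mathrm{Hom}(\mathfrak g,\mathfrak g)$ and $x\in\mathfrak g$: $$(\delta^1 f)(u_1,u_2)=[u_1,f(u_2)]+[f(u_1),u_2]-f([u_1,u_2]),$$ $$(\partial^0 x)(u)=-[x,\theta(u)]+\theta([x,u]),\qquad \phi^1 f=f\circ\theta-\theta\circ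 f.$$ Two elements of $C^2_{\mathrm{AL}}(\mathfrak g,\mathfrak g)$ are in the same cohomology class if their difference is in the image of $d^1$. *)

(* Defs.v *)
From HB Require Import structures.
From mathcomp Require Import all_boot all_order all_algebra.
From mathcomp Require Import boolp functions.

Set Implicit Arguments.
Unset Strict Implicit.
Unset Printing Implicit Defensive.

Import GRing.Theory.
Local Open Scope ring_scope.

Section TripleSums.
Variable V : nmodType.
Implicit Type F : nat -> nat -> nat -> V.

Lemma sum_triangle (G : nat -> nat -> V) n :
  \sum_(i < n.+1) \sum_(j < (n - i).+1) G i j =
  \sum_(i < n.+1) \sum_(j < n.+1 | (i + j <= n)%N) G i j.
Proof.
apply: eq_bigr => i _.
have le : ((n - i).+1 <= n.+1)%N by rewrite ltnS leq_subr.
rewrite (big_ord_widen _ (G i) le).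
by apply: eq_bigl => j; rewrite ltnS leq_subRL // -ltnS.
Qed.

Lemma sum_triangle_swap F n :
  \sum_(i < n.+1) \sum_(j < (n - i).+1) F i j (n - i - j)%N =
  \sum_(j < n.+1) \sum_(i < (n - j).+1) F i j (n - j - i)%N.
Proof.
rewrite (sum_triangle (fun i j => F i j (n - i - j)%N)).
rewrite (sum_triangle (fun j i => F i j (n - j - i)%N)).
rewrite (exchange_big_dep xpredT) //=.
by apply: eq_bigr => j _; apply: eq_big => i; rewrite 1?addnC // subnAC.
Qed.

Lemma sum_rev (G : nat -> nat -> V) n :
  \sum_(i < n.+1) G i (n - i)%N = \sum_(i < n.+1) G (n - i)%N i.
Proof.
rewrite (reindex_inj rev_ord_inj) /=; apply: eq_bigr => i _.
by rewrite subSS subKn // -ltnS.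
Qed.

Lemma sum_triangle_assoc F n :
  \sum_(i < n.+1) \sum_(j < (n - i).+1) F i j (n - i - j)%N =
  \sum_(k < n.+1) \sum_(i < k.+1) F i (k - i)%N (n - k)%N.
Proof.
rewrite (sum_rev (fun k l => \sum_(i < k.+1) F i (k - i)%N l)).
rewrite -(sum_triangle_swap (fun i k j => F i j k)).
by apply: eq_bigr => i _; exact: (sum_rev (F i)).
Qed.

End TripleSums.

(* V[[t]]: the function u stands for the series whose t^n-coefficient is u n.
   A separate name is needed because nat -> V already carries the pointwise
   product and scaling. *)
Definition fps (V : Type) : Type := nat -> V.

HB.instance Definition _ (V : zmodType) :=
  GRing.Zmodule.copy (fps V) (nat -> V).

Section SeriesRing.
Variable R : comNzRingType.
Implicit Types a b c : fps R.

Definition fps_one : fps R := fun n => (n == 0%N)%:R.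
Definition fps_mul a b : fps R := fun n => \sum_(i < n.+1) a i * b (n - i)%N.

Fact fps_mulC : commutative fps_mul.
Proof.
move=> a b; apply/funext => n; rewrite /fps_mul (sum_rev (fun i j => a i * b j)).
by apply: eq_bigr => i _; rewrite mulrC.
Qed.

Fact fps_mulA : associative fps_mul.
Proof.
move=> a b c; apply/funext => n; rewrite /fps_mul.
under eq_bigr do rewrite mulr_sumr; under [RHS]eq_bigr do rewrite mulr_suml.
rewrite (sum_triangle_assoc (fun i j k => a i * (b j * c k))).
by apply: eq_bigr => i _; apply: eq_bigr => j _; rewrite mulrA.
Qed.

Fact fps_mul1 : left_id fps_one fps_mul.
Proof.
move=> a; apply/funext => n; rewrite /fps_mul big_ord_recl big1 ?addr0.
  by rewrite /fps_one mul1r subn0.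
by move=> i _; rewrite /fps_one mul0r.
Qed.

Fact fps_mulDl : left_distributive fps_mul +%R.
Proof.
move=> a b c; apply/funext => n; rewrite /fps_mul.
transitivity (\sum_(i < n.+1) a i * c (n - i)%N
              + \sum_(i < n.+1) b i * c (n - i)%N); last by [].
by rewrite -big_split; apply: eq_bigr => i _; rewrite mulrDl.
Qed.

Fact fps_one_neq0 : fps_one != 0.
Proof.
apply/eqP => /(congr1 (fun a : fps R => a 0%N)) /eqP.
by rewrite /fps_one eqxx (oner_eq0 R).
Qed.

HB.instance Definition _ := GRing.Zmodule_isComNzRing.Build (fps R)
  fps_mulA fps_mulC fps_mul1 fps_mulDl fps_one_neq0.

End SeriesRing.

Section SeriesModule.
Variables (R : comNzRingType) (V : lmodType R).
Implicit Types (a b : fps R) (u v w : fps V).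

Definition fps_scale a u : fps V := fun n => \sum_(i < n.+1) a i *: u (n - i)%N.

Fact fps_scaleA a b u : fps_scale a (fps_scale b u) = fps_scale (a * b) u.
Proof.
apply/funext => n; rewrite /fps_scale.
under eq_bigr do rewrite scaler_sumr; under [RHS]eq_bigr do rewrite scaler_suml.
rewrite (sum_triangle_assoc (fun i j k => a i *: (b j *: u k))).
by apply: eq_bigr => i _; apply: eq_bigr => j _; rewrite scalerA.
Qed.

Fact fps_scale1 : left_id 1 fps_scale.
Proof.
move=> u; apply/funext => n; rewrite /fps_scale big_ord_recl big1 ?addr0.
  by rewrite [X in X *: _](_ : _ = 1) // scale1r subn0.
by move=> i _; rewrite [X in X *: _](_ : _ = 0) // scale0r.
Qed.

Fact fps_scaleDr : right_distributive fps_scale +%R.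
Proof.
move=> a u v; apply/funext => n; rewrite /fps_scale.
transitivity (\sum_(i < n.+1) a i *: u (n - i)%N
              + \sum_(i < n.+1) a i *: v (n - i)%N); last by [].
by rewrite -big_split; apply: eq_bigr => i _; rewrite scalerDr.
Qed.

Fact fps_scaleDl u : {morph fps_scale^~ u : a b / a + b}.
Proof.
move=> a b; apply/funext => n; rewrite /fps_scale.
transitivity (\sum_(i < n.+1) a i *: u (n - i)%N
              + \sum_(i < n.+1) b i *: u (n - i)%N); last by [].
by rewrite -big_split; apply: eq_bigr => i _; rewrite scalerDl.
Qed.

HB.instance Definition _ := GRing.Zmodule_isLmodule.Build (fps R) (fps V)
  fps_scaleA fps_scale1 fps_scaleDr fps_scaleDl.

Fact fps_conv_linear (f : nat -> V -> V) : (forall i, linear (f i)) ->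
  linear (fun u : fps V => (fun n => \sum_(i < n.+1) f i (u (n - i)%N)) : fps V).
Proof.
move=> lin a u v; apply/funext => n.
transitivity (\sum_(i < n.+1) a i *: (\sum_(j < (n - i).+1) f j (u (n - i - j)%N))
              + \sum_(i < n.+1) f i (v (n - i)%N)); last by [].
under [X in _ = X + _]eq_bigr do rewrite scaler_sumr.
rewrite (sum_triangle_swap (fun i j k => a i *: f j (u k))) -big_split.
apply: eq_bigr => i _ /=.
pose mf := GRing.isLinear.Build R V V *:%R (f i) (lin i).
pose F : {linear V -> V} := HB.pack (f i) mf.
have -> : (a *: u + v) (n - i)%N =
  \sum_(j < (n - i).+1) a j *: u (n - i - j)%N + v (n - i)%N by [].
rewrite -[f i]/(F : V -> V) linearD linear_sum; congr (_ + _).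
by apply: eq_bigr => j _; rewrite linearZ.
Qed.

(* The R[[t]]-linear extensions to V[[t]] of a series of linear maps and of a
   series of bilinear maps. *)
Definition fps_op (th : nat -> {linear V -> V}) u : fps V :=
  fun n => \sum_(i < n.+1) th i (u (n - i)%N).

Definition fps_br (mu : nat -> {bilinear V -> V -> V}) u v : fps V :=
  fun n => \sum_(i < n.+1) \sum_(j < (n - i).+1) mu i (u j) (v (n - i - j)%N).

Fact fps_op_is_linear th : linear (fps_op th).
Proof.
by apply: (fps_conv_linear (f := fun i => th i)) => i; exact: linearP.
Qed.

HB.instance Definition _ th :=
  GRing.isLinear.Build (fps R) (fps V) (fps V) *:%R (fps_op th)
    (fps_op_is_linear th).

Fact fps_br_is_bilinear mu : bilinear_for *:%R *:%R (fps_br mu).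
Proof.
split=> [v | u].
  rewrite (_ : (fps_br mu)^~ v = fun u : fps V => (fun n => \sum_(j < n.+1)
      \sum_(i < j.+1) mu i (u (n - j)%N) (v (j - i)%N)) : fps V); last first.
    apply/funext => u; apply/funext => n; rewrite /fps_br.
    under eq_bigr do rewrite (sum_rev (fun j k => mu _ (u j) (v k))).
    by rewrite (sum_triangle_assoc (fun i k j => mu i (u j) (v k))).
  apply: (fps_conv_linear (f := fun j x =>
    \sum_(i < j.+1) mu i x (v (j - i)%N))) => j a x y.
  rewrite scaler_sumr -big_split.
  by apply: eq_bigr => i _; rewrite linearPl.
rewrite (_ : fps_br mu u = fun v : fps V => (fun n => \sum_(k < n.+1)
    \sum_(i < k.+1) mu i (u (k - i)%N) (v (n - k)%N)) : fps V); last first.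
  apply/funext => v; apply/funext => n.
  by rewrite /fps_br (sum_triangle_assoc (fun i j k => mu i (u j) (v k))).
apply: (fps_conv_linear (f := fun k x =>
  \sum_(i < k.+1) mu i (u (k - i)%N) x)) => j a x y.
rewrite scaler_sumr -big_split.
by apply: eq_bigr => i _; rewrite linearPr.
Qed.

HB.instance Definition _ mu :=
  bilinear_isBilinear.Build (fps R) (fps V) (fps V) (fps V) *:%R *:%R
    (fps_br mu) (fps_br_is_bilinear mu).

End SeriesModule.

Section AveragingLeibniz.
Variables (R : comNzRingType) (V : lmodType R).
Implicit Types (br : {bilinear V -> V -> V}) (th : {linear V -> V}).

Definition leibniz br : Prop :=
  forall u v w, br u (br v w) = br (br u v) w + br v (br u w).

Definition averaging br th : Prop :=
  forall u v, br (th u) (th v) = th (br (th u) v) /\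
              br (th u) (th v) = th (br u (th v)).

Definition averaging_leibniz br th : Prop := leibniz br /\ averaging br th.

End AveragingLeibniz.

Section Deformations.
Variables (K : fieldType) (g : lmodType K).
Variables (mu : {bilinear g -> g -> g}) (th : {linear g -> g}).

Record deformation : Type := Deformation {
  dbr : nat -> {bilinear g -> g -> g};
  dop : nat -> {linear g -> g};
  dbr0 : dbr 0%N =2 mu;
  dop0 : dop 0%N =1 th;
  dfm_averaging_leibniz :
    averaging_leibniz (R := fps K) (V := fps g) (fps_br dbr) (fps_op dop)
}.

Definition equivalent_deformations (D D' : deformation) : Prop :=
  exists psi : nat -> {linear g -> g},
    [/\ psi 0%N =1 id,
        forall u v : fps g, fps_op psi (fps_br (dbr D') u v) =
          fps_br (dbr D) (fps_op psi u) (fps_op psi v) &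
        forall u : fps g, fps_op psi (fps_op (dop D') u) =
          fps_op (dop D) (fps_op psi u)].

(* Hom(K, g) is identified with g, and Hom(g (x) g, g) with bilinear maps. *)
Definition C1 : Type := ({linear g -> g} * g)%type.
Definition C2 : Type := ({bilinear g -> g -> g} * {linear g -> g})%type.

Definition delta1 (f : {linear g -> g}) (u v : g) : g :=
  mu u (f v) + mu (f u) v - f (mu u v).

Definition partial0 (x u : g) : g := - mu x (th u) + th (mu x u).

Definition phi1 (f : {linear g -> g}) (u : g) : g := f (th u) - th (f u).

Definition d1_op (f : {linear g -> g}) (x u : g) : g :=
  - partial0 x u - phi1 f u.

Fact delta1_is_bilinear f : bilinear_for *:%R *:%R (delta1 f).
Proof.
have alg (a : K) (p q r p' q' r' : g) :
    a *: p + p' + (a *: q + q') - (a *: r + r') = a *: (p + q - r) + (p' + q' - r').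
  by rewrite !scalerDr scalerN opprD (addrACA (a *: p)) [LHS]addrACA.
split=> [v | u] a x y; rewrite /delta1.
  by rewrite !linearPl linearP linearPl linearP alg.
by rewrite !linearPr linearP linearPr linearP alg.
Qed.

HB.instance Definition _ f :=
  bilinear_isBilinear.Build K g g g *:%R *:%R (delta1 f) (delta1_is_bilinear f).

Fact d1_op_is_linear f x : linear (d1_op f x).
Proof.
have add (a : K) (p q p' q' : g) :
    (a *: p + p') + (a *: q + q') = a *: (p + q) + (p' + q').
  by rewrite scalerDr addrACA.
move=> a u v; rewrite /d1_op /partial0 /phi1 !(addrC (- mu _ _)) !opprB.
by rewrite !linearP !add.
Qed.

HB.instance Definition _ f x :=
  GRing.isLinear.Build K g g *:%R (d1_op f x) (d1_op_is_linear f x).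

Definition d1 (c : C1) : C2 :=
  (delta1 c.1 : {bilinear g -> g -> g}, d1_op c.1 c.2 : {linear g -> g}).

Definition infinitesimal (D : deformation) : C2 := (dbr D 1%N, dop D 1%N).

Definition cohomologous (c c' : C2) : Prop :=
  exists b : C1, (forall u v, c'.1 u v - c.1 u v = (d1 b).1 u v) /\
                 (forall u, c'.2 u - c.2 u = (d1 b).2 u).

End Deformations.

(* Main.v *)
Require Import Defs.
From HB Require Import structures.
From mathcomp Require Import all_boot all_order all_algebra.
From mathcomp Require Import boolp functions.
Import GRing.Theory.
Local Open Scope ring_scope.

(** An equivalence [psi] is in particular an identity between power series;
    evaluated on constant series [u], [v] and read off at [t^1], where
    [psi 0 = id], it says
    [mu'_1 (u, v) + psi_1 [u, v] = mu_1 (u, v) + [psi_1 u, v] + [u, psi_1 v]]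
    and [theta'_1 u + psi_1 (theta u) = theta_1 u + theta (psi_1 u)].
    Hence the difference of the infinitesimals is
    [(delta^1 psi_1, - phi^1 psi_1)], which is [d^1 (psi_1, 0)]: the component
    of the 1-cochain in [Hom(K, g) = g] can be taken to be zero, and then
    [partial^0] contributes nothing. *)

Section LowCoefficients.
Variables (R : comNzRingType) (V : lmodType R).

Lemma fps_op_coef0 (f : nat -> {linear V -> V}) (u : fps V) :
  fps_op f u 0%N = f 0%N (u 0%N).
Proof. by rewrite /fps_op big_ord1. Qed.

Lemma fps_op_coef1 (f : nat -> {linear V -> V}) (u : fps V) :
  fps_op f u 1%N = f 0%N (u 1%N) + f 1%N (u 0%N).
Proof. by rewrite /fps_op big_ord_recl big_ord1. Qed.

Lemma fps_br_coef0 (m : nat -> {bilinear V -> V -> V}) (u v : fps V) :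
  fps_br m u v 0%N = m 0%N (u 0%N) (v 0%N).
Proof. by rewrite /fps_br !big_ord1. Qed.

Lemma fps_br_coef1 (m : nat -> {bilinear V -> V -> V}) (u v : fps V) :
  fps_br m u v 1%N = m 0%N (u 0%N) (v 1%N) + m 0%N (u 1%N) (v 0%N)
                     + m 1%N (u 0%N) (v 0%N).
Proof. by rewrite /fps_br big_ord_recl big_ord1 /= big_ord_recl !big_ord1. Qed.

End LowCoefficients.

Definition fps_const {V : nmodType} (x : V) : fps V :=
  fun n => if n is 0%N then x else 0.

Theorem theorem5p6 (K : fieldType) (charK0 : [pchar K] =i pred0)
    (g : lmodType K) (mu : {bilinear g -> g -> g}) (th : {linear g -> g})
    (ALg : averaging_leibniz mu th) (D D' : deformation mu th) :
  equivalent_deformations D D' ->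
  cohomologous mu th (infinitesimal D) (infinitesimal D').
Proof.
case=> psi [psi0 psi_br psi_op]; exists (psi 1%N, 0).
split=> [u v | u] /=.
- have := congr1 (fun s : fps g => s 1%N)
                 (psi_br (fps_const u) (fps_const v)).
  rewrite fps_op_coef1 !fps_br_coef1 fps_br_coef0 !fps_op_coef0 !fps_op_coef1.
  rewrite /= !psi0 !dbr0 /= !linear0 linear0l !add0r => mu1E.
  rewrite /delta1 -(addrK (psi 1%N (mu u v)) (dbr D' 1%N u v)) mu1E.
  by rewrite addrAC addrK.
(* The minus sign in front of [phi1] is what matches the order
   [theta psi_1 - psi_1 theta] given by the equivalence. *)
have := congr1 (fun s : fps g => s 1%N) (psi_op (fps_const u)).
rewrite !fps_op_coef1 !fps_op_coef0 /= !psi0 !dop0 /=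
  !linear0 !add0r => th1E.
rewrite /d1_op /partial0 /phi1 !linear0l !linear0 addr0 oppr0 add0r opprB.
rewrite -(addrK (psi 1%N (th u)) (dop D' 1%N u)) th1E.
by rewrite addrAC addrK.
Qed.
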